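(* Let $\mathcal{A}$ be a set of quantifier-free axioms in $\mathcal{L}$ and let $\mathcal{B}$ be a theory in $\mathcal{L}$. (i) Let $\Phi$ be a class of bounded formulas containing all quantifier-free formulas and closed under boolean operations, substitution and subformulas, and let $k\ge 0$. If $\Gamma(\vec{x})\rhd_d^{(\Pi_k(\Phi),\mathcal{B})}\Delta(\vec{x})$ and $\mathcal{B}\subseteq\mathfrak{B}(\mathbb{T}_{all},\Pi_k(\Phi),\mathcal{A})$, then $\mathfrak{B}(\mathbb{T}_{all},\Pi_k(\Phi),\mathcal{A})\vdash\Gamma(\vec{x})\Rightarrow\Delta(\vec{x})$. (ii) Let $\mathbb{T}$ be an $\mathcal{A}$-term ideal and $\Pi$ a $\pi$-class of (bounded) formulas. If $\Gamma(\vec{x})\rhd_n^{(\mathbb{T},\Pi,\mathcal{B})}\Delta(\vec{x})$ and $\mathcal{B}\subseteq\mathfrak{B}(\mathbb{T},\Pi,\mathcal{A})$, then $\mathfrak{B}(\mathbb{T},\Pi,\mathcal{A})\vdash\Gamma(\vec{x})\Rightarrow\Delta(\vec{x})$.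
   Context: **Language and base theory.** $\mathcal{L}$ is a first-order language of arithmetic extending $\{0,1,+,-,\cdot,\lfloor\frac{\cdot}{\cdot}\rfloor,\le\}$. $\mathcal{R}$ is the theory of commutative discrete ordered semirings (commutative ring axioms without additive inverses, plus: $\le$ is a total discrete order with $<$ compatible with addition and with multiplication by non-zero elements) together with $(x\ge y\to (x-y)+y=x)\wedge(x<y\to x-y=0)$ and $((y+1)\cdot\lfloor\frac{x}{y}\rfloor\le x)\wedge(x-(y+1)\cdot\lfloor\frac{x}{y}\rfloor<y+1)$ (so $\lfloor\frac{x}{y}\rfloor$ really denotes $\lfloor x/(y+1)\rfloor$). All axiom sets $\mathcal A$ and theories $\mathcal B$ are assumed to contain $\mathcal R$. **Term ideals.** A class $\mathbb{T}$ of terms is a $\mathcal{B}$-term set if, provably in $\mathcal{B}$, it is closed under the basic operations of the language of $\mathcal{R}$ and under substitution: if $t(\vec x,y)\in\mathbb{T}$ and $s$ is any term, $t(\vec x,s)$ is $\mathcal{B}$-provably equal to a term in $\mathbb{T}$. It is a $\mathcal{B}$-term ideal if moreover there is $X\subseteq\mathbb{T}$ such that each $t\in\mathbb{T}$ has $s\in X$ with $\mathcal{B}\vdash t(\vec x)\le s(\vec x)$, and each $r\in X$ is $\mathcal{B}$-provably monotone ($\vec x\le\vec y\to r(\vec x)\le r(\vec y)$). $\mathbb{T}_{all}$ is the class of all terms; whenever $\mathfrak B(\mathbb T_{all},\cdot,\mathcal A)$ is used, $\mathbb T_{all}$ is assumed to be an $\mathcal A$-term ideal. **Bounded arithmetic.**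 For a set $\mathcal{A}$ of quantifier-free axioms, an $\mathcal{A}$-term ideal $\mathbb{T}$, and a class $\Psi$ of bounded formulas closed under substitution and subformulas, $\mathfrak{B}(\mathbb{T},\Psi,\mathcal{A})$ is the first-order theory in $\mathcal{L}$ with axioms $\mathcal{A}$ and $A(0)\wedge\forall x(A(x)\to A(x+1))\to\forall x\,A(t(x))$ for $A\in\Psi$, $t\in\mathbb{T}$. A theory proves a sequent $\Gamma\Rightarrow\Delta$ iff it proves $\bigwedge\Gamma\to\bigvee\Delta$. **$\pi$-class.** An $\mathcal{R}$-conjunction (disjunction, negation, bounded quantification) of formulas is a formula $\mathcal{R}$-provably equivalent to the conjunction (etc.). A class $\Pi$ of formulas is a $\pi$-class if it contains all quantifier-free formulas, is closed under substitution, subformulas, an $\mathcal{R}$-conjunction, an $\mathcal{R}$-disjunction and an $\mathcal{R}$-bounded universal quantification, and if $\exists y\le t\,B(y)\in\Pi$ then $B$ has an $\mathcal{R}$-negation in $\Pi$ and $\forall y\le t\,\neg B(y)$ has an $\mathcal{R}$-negation in $\Pi$. **Hierarchy.** $\Pi_0(\Phi)=\Sigma_0(\Phi)=\Phi$; $\Sigma_{k+1}(\Phi)$ consists of formulas with a block of bounded existential quantifiers in front of a $\Pi_k(\Phi)$ formula, and $\Pi_{k+1}(\Phi)$ of formulas with a block of bounded universal quantifiers in front of a $\Sigma_k(\Phi)$ formula. Boolean combinations such as $\bigwedge\Gamma$, $\bigvee\Delta$ are replaced by $\mathcal{R}$-equivalent prenex formulas in the relevant class. **Deterministic reductions.** For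 $A,B$ both in $\Pi_k(\Phi)$ or both in $\Sigma_k(\Phi)$ and a sequence of terms $F=(F_i)_{i=1}^k$, define $A\le_d^{F,k}B$ by recursion on $k$. For $k=0$: $F$ is empty and $\mathcal{B}\vdash A\to B$. If $A=\forall\vec u\le\vec p(\vec x)\,C(\vec x,\vec u)$, $B=\forall\vec v\le\vec q(\vec x)\,D(\vec x,\vec v)$: $A\le_d^{F,k+1}B$ iff $\mathcal{B}\vdash\vec v\le\vec q(\vec x)\to F_{k+1}(\vec x,\vec v)\le\vec p(\vec x)$ and $\big(F_{k+1}(\vec x,\vec v)\le\vec p(\vec x)\to C(\vec x,F_{k+1}(\vec x,\vec v))\big)\le_d^{\hat F,k}\big(\vec v\le\vec q(\vec x)\to D(\vec x,\vec v)\big)$ with $\hat F=(F_i)_{i=1}^{k}$. If $A=\exists\vec u\le\vec p(\vec x)\,C$, $B=\exists\vec v\le\vec q(\vec x)\,D$: iff $\mathcal{B}\vdash\vec u\le\vec p(\vec x)\to F_{k+1}(\vec x,\vec u)\le\vec q(\vec x)$ and $\big(\vec u\le\vec p(\vec x)\wedge C(\vec x,\vec u)\big)\le_d^{\hat F,k}\big(F_{k+1}(\vec x,\vec u)\le\vec q(\vec x)\wedge D(\vec x,F_{k+1}(\vec x,\vec u))\big)$. $A\equiv_d^{(E_0,E_1)}B$ means $A\le_d^{E_0}B$ and $B\le_d^{E_1}A$. **Deterministic flow.** For $A,B\in\Pi_k(\Phi)$, $A\rhd_d^{(\Pi_k(\Phi),\mathcal{B})}B$ means there are a term $t(\vec x)$,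 a formula $H(u,\vec x)\in\Pi_k(\Phi)$ and sequences of terms $E_0,E_1,G_0,G_1,F(u)$ such that, provably in $\mathcal{B}$: $H(0,\vec x)\equiv_d^{(E_0,E_1)}A(\vec x)$; $H(t(\vec x),\vec x)\equiv_d^{(G_0,G_1)}B(\vec x)$; and for all $u<t(\vec x)$, $H(u,\vec x)\le_d^{F(u)}H(u+1,\vec x)$. **Non-deterministic flow.** For $A,B\in\Pi$, $A\rhd_n^{(\mathbb{T},\Pi,\mathcal{B})}B$ means there are $t(\vec x)\in\mathbb{T}$ and $H(u,\vec x)\in\Pi$ with $\mathcal{B}\vdash H(0,\vec x)\leftrightarrow A(\vec x)$, $\mathcal{B}\vdash H(t(\vec x),\vec x)\leftrightarrow B(\vec x)$ and $\mathcal{B}\vdash\forall u<t(\vec x)\,(H(u,\vec x)\to H(u+1,\vec x))$. For finite multisets $\Gamma,\Delta$ of formulas of the class in question, $\Gamma\rhd\Delta$ means $\bigwedge\Gamma\rhd\bigvee\Delta$. *)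

(* Defs.v *)
From Stdlib Require List.
From mathcomp Require Import all_boot.

Set Implicit Arguments.
Unset Strict Implicit.
Unset Printing Implicit Defensive.

Declare Scope fol_scope.
Delimit Scope fol_scope with fol.

(** * Syntax *)

(** A language [L] lists only the symbols to be added to
    {0, 1, +, -, *, |_ / _|, <=}; the latter are built into [term] and
    [formula]. *)
Record language := Language {
  fun_sym : Type;
  fun_ar : fun_sym -> nat;
  rel_sym : Type;
  rel_ar : rel_sym -> nat
}.

(** [Tdiv s t] is the term written |_ s / t _|; by the axioms of [Rth] it
    denotes the floor of s / (t + 1). *)
Inductive term (L : language) : Type :=
| Tvar of nat
| Tzero
| Tone
| Tadd of term L & term L
| Tsub of term L & term L
| Tmul of term L & term L
| Tdiv of term L & term L
| Tfun (f : fun_sym L) of ('I_(fun_ar f) -> term L).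

Arguments Tvar {L} _.
Arguments Tzero {L}.
Arguments Tone {L}.

(** De Bruijn syntax.  Bounded quantifiers are primitive, so that the body [A]
    is an immediate subformula of [Ball t A] and [Bex t A].  The bound [t]
    lives outside the scope of the quantifier. *)
Inductive formula (L : language) : Type :=
| Feq of term L & term L
| Fle of term L & term L
| Frel (r : rel_sym L) of ('I_(rel_ar r) -> term L)
| Fbot
| Fand of formula L & formula L
| For of formula L & formula L
| Fimp of formula L & formula L
| Fall of formula L
| Fex of formula L
| Ball of term L & formula L
| Bex of term L & formula L.

Arguments Fbot {L}.

Section Connectives.
Variable L : language.
Implicit Types (s t : term L) (A B : formula L) (Gamma : seq (formula L)).

Definition Fneg A := Fimp A Fbot.
Definition Ftop : formula L := Fimp Fbot Fbot.
Definition Fiff A B := Fand (Fimp A B) (Fimp B A).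
Definition Flt s t := Fand (Fle s t) (Fneg (Feq s t)).
Definition Fbigand Gamma := foldr (@Fand L) Ftop Gamma.
Definition Fbigor Gamma := foldr (@For L) Fbot Gamma.
End Connectives.

Arguments Ftop {L}.

Notation "s ⊕ t" := (Tadd s t) (at level 50, left associativity) : fol_scope.
Notation "s ⊖ t" := (Tsub s t) (at level 50, left associativity) : fol_scope.
Notation "s ⊗ t" := (Tmul s t) (at level 40, left associativity) : fol_scope.
Notation "s ≐ t" := (Feq s t) (at level 70) : fol_scope.
Notation "s ≼ t" := (Fle s t) (at level 70) : fol_scope.
Notation "s ≺ t" := (Flt s t) (at level 70) : fol_scope.
Notation "¬ A" := (Fneg A) (at level 75, right associativity) : fol_scope.
Notation "A ∧ B" := (Fand A B) (at level 80, right associativity) : fol_scope.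
Notation "A ∨ B" := (For A B) (at level 85, right associativity) : fol_scope.
Notation "A ⟶ B" := (Fimp A B) (at level 90, right associativity) : fol_scope.
Notation "A ⟷ B" := (Fiff A B) (at level 95) : fol_scope.

Local Open Scope fol_scope.

(** * Substitution *)

Section Substitution.
Variable L : language.
Implicit Types (s t : term L) (A : formula L) (sigma : nat -> term L).

Fixpoint tsubst sigma t : term L :=
  match t with
  | Tvar n => sigma n
  | Tzero => Tzero
  | Tone => Tone
  | Tadd t1 t2 => Tadd (tsubst sigma t1) (tsubst sigma t2)
  | Tsub t1 t2 => Tsub (tsubst sigma t1) (tsubst sigma t2)
  | Tmul t1 t2 => Tmul (tsubst sigma t1) (tsubst sigma t2)
  | Tdiv t1 t2 => Tdiv (tsubst sigma t1) (tsubst sigma t2)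
  | Tfun f a => Tfun (fun i => tsubst sigma (a i))
  end.

Definition shift (n : nat) : nat -> term L := fun i => Tvar (n + i).

Definition up sigma : nat -> term L :=
  fun i => if i is j.+1 then tsubst (shift 1) (sigma j) else Tvar 0.

Fixpoint fsubst sigma A : formula L :=
  match A with
  | Feq t1 t2 => Feq (tsubst sigma t1) (tsubst sigma t2)
  | Fle t1 t2 => Fle (tsubst sigma t1) (tsubst sigma t2)
  | Frel r a => Frel (fun i => tsubst sigma (a i))
  | Fbot => Fbot
  | Fand A1 A2 => Fand (fsubst sigma A1) (fsubst sigma A2)
  | For A1 A2 => For (fsubst sigma A1) (fsubst sigma A2)
  | Fimp A1 A2 => Fimp (fsubst sigma A1) (fsubst sigma A2)
  | Fall A1 => Fall (fsubst (up sigma) A1)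
  | Fex A1 => Fex (fsubst (up sigma) A1)
  | Ball t A1 => Ball (tsubst sigma t) (fsubst (up sigma) A1)
  | Bex t A1 => Bex (tsubst sigma t) (fsubst (up sigma) A1)
  end.

(** [inst s] discards variable 0 in favour of [s] (elimination of a binder);
    [upd y s] replaces the variable [y] by [s] and renumbers nothing. *)
Definition inst s : nat -> term L :=
  fun i => if i is j.+1 then Tvar j else s.

Definition upd (y : nat) s : nat -> term L :=
  fun i => if i == y then s else Tvar i.

(** A strict upper bound on the indices of the variables of [t]. *)
Fixpoint tbound t : nat :=
  match t with
  | Tvar n => n.+1
  | Tzero | Tone => 0
  | Tadd t1 t2 | Tsub t1 t2 | Tmul t1 t2 | Tdiv t1 t2 =>
      maxn (tbound t1) (tbound t2)
  | Tfun f a => \max_(i < fun_ar f) tbound (a i)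
  end.

Fixpoint quantifier_free A : Prop :=
  match A with
  | Feq _ _ | Fle _ _ | Frel _ _ | Fbot => True
  | Fand A1 A2 | For A1 A2 | Fimp A1 A2 =>
      quantifier_free A1 /\ quantifier_free A2
  | Fall _ | Fex _ | Ball _ _ | Bex _ _ => False
  end.

Fixpoint bounded A : Prop :=
  match A with
  | Feq _ _ | Fle _ _ | Frel _ _ | Fbot => True
  | Fand A1 A2 | For A1 A2 | Fimp A1 A2 => bounded A1 /\ bounded A2
  | Ball _ A1 | Bex _ A1 => bounded A1
  | Fall _ | Fex _ => False
  end.

Inductive subformula : formula L -> formula L -> Prop :=
| sub_refl A : subformula A A
| sub_andl A B C : subformula A B -> subformula A (Fand B C)
| sub_andr A B C : subformula A C -> subformula A (Fand B C)
| sub_orl A B C : subformula A B -> subformula A (For B C)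
| sub_orr A B C : subformula A C -> subformula A (For B C)
| sub_impl A B C : subformula A B -> subformula A (Fimp B C)
| sub_impr A B C : subformula A C -> subformula A (Fimp B C)
| sub_all A B : subformula A B -> subformula A (Fall B)
| sub_ex A B : subformula A B -> subformula A (Fex B)
| sub_ball A t B : subformula A B -> subformula A (Ball t B)
| sub_bex A t B : subformula A B -> subformula A (Bex t B).

End Substitution.

Arguments shift {L} n i.

(** * Provability *)

(** A theory is given by a set of axioms. *)
Definition theory (L : language) := formula L -> Prop.

(** Classical natural deduction with equality.  The free variables of an axiom
    are read universally: the quantifier rules shift the hypotheses but not the
    axioms, so every axiom may be generalized. *)
Inductive prv (L : language) (T : theory L) :
    seq (formula L) -> formula L -> Prop :=
| prv_ax Gamma A : T A -> prv T Gamma A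
| prv_hyp Gamma A : List.In A Gamma -> prv T Gamma A
| prv_raa Gamma A : prv T ((¬ A) :: Gamma) Fbot -> prv T Gamma A
| prv_andI Gamma A B : prv T Gamma A -> prv T Gamma B -> prv T Gamma (A ∧ B)
| prv_andE1 Gamma A B : prv T Gamma (A ∧ B) -> prv T Gamma A
| prv_andE2 Gamma A B : prv T Gamma (A ∧ B) -> prv T Gamma B
| prv_orI1 Gamma A B : prv T Gamma A -> prv T Gamma (A ∨ B)
| prv_orI2 Gamma A B : prv T Gamma B -> prv T Gamma (A ∨ B)
| prv_orE Gamma A B C :
    prv T Gamma (A ∨ B) -> prv T (A :: Gamma) C -> prv T (B :: Gamma) C ->
    prv T Gamma C
| prv_impI Gamma A B : prv T (A :: Gamma) B -> prv T Gamma (A ⟶ B)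
| prv_impE Gamma A B : prv T Gamma (A ⟶ B) -> prv T Gamma A -> prv T Gamma B
| prv_allI Gamma A : prv T (map (fsubst (shift 1)) Gamma) A ->
    prv T Gamma (Fall A)
| prv_allE Gamma A s : prv T Gamma (Fall A) -> prv T Gamma (fsubst (inst s) A)
| prv_exI Gamma A s : prv T Gamma (fsubst (inst s) A) -> prv T Gamma (Fex A)
| prv_exE Gamma A C :
    prv T Gamma (Fex A) ->
    prv T (A :: map (fsubst (shift 1)) Gamma) (fsubst (shift 1) C) ->
    prv T Gamma C
| prv_ballI Gamma t A :
    prv T ((Tvar 0 ≼ tsubst (shift 1) t) :: map (fsubst (shift 1)) Gamma) A ->
    prv T Gamma (Ball t A)
| prv_ballE Gamma t A s :
    prv T Gamma (Ball t A) -> prv T Gamma (s ≼ t) ->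
    prv T Gamma (fsubst (inst s) A)
| prv_bexI Gamma t A s :
    prv T Gamma (s ≼ t) -> prv T Gamma (fsubst (inst s) A) ->
    prv T Gamma (Bex t A)
| prv_bexE Gamma t A C :
    prv T Gamma (Bex t A) ->
    prv T (A :: (Tvar 0 ≼ tsubst (shift 1) t) :: map (fsubst (shift 1)) Gamma)
      (fsubst (shift 1) C) ->
    prv T Gamma C
| prv_eqI Gamma t : prv T Gamma (t ≐ t)
| prv_eqE Gamma A s t :
    prv T Gamma (s ≐ t) -> prv T Gamma (fsubst (inst s) A) ->
    prv T Gamma (fsubst (inst t) A).

Notation "T ⊢ A" := (prv T [::] A) (at level 99, no associativity) : fol_scope.

Definition proves_sequent (L : language) (T : theory L)
    (Gamma Delta : seq (formula L)) : Prop :=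
  T ⊢ (Fbigand Gamma ⟶ Fbigor Delta).

Definition subtheory (L : language) (S T : theory L) : Prop :=
  forall A, (S ⊢ A) -> (T ⊢ A).

(** * The base theory *)

Section BaseTheory.
Variable L : language.
Local Notation x := (@Tvar L 0).
Local Notation y := (@Tvar L 1).
Local Notation z := (@Tvar L 2).

Inductive Rth : theory L :=
| R_addA : Rth (x ⊕ (y ⊕ z) ≐ (x ⊕ y) ⊕ z)
| R_addC : Rth (x ⊕ y ≐ y ⊕ x)
| R_add0 : Rth (x ⊕ Tzero ≐ x)
| R_mulA : Rth (x ⊗ (y ⊗ z) ≐ (x ⊗ y) ⊗ z)
| R_mulC : Rth (x ⊗ y ≐ y ⊗ x)
| R_mul1 : Rth (x ⊗ Tone ≐ x)
| R_mul0 : Rth (x ⊗ Tzero ≐ Tzero)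
| R_mulD : Rth (x ⊗ (y ⊕ z) ≐ (x ⊗ y) ⊕ (x ⊗ z))
| R_le_refl : Rth (x ≼ x)
| R_le_anti : Rth (x ≼ y ∧ y ≼ x ⟶ x ≐ y)
| R_le_trans : Rth (x ≼ y ∧ y ≼ z ⟶ x ≼ z)
| R_le_total : Rth (x ≼ y ∨ y ≼ x)
| R_discrete : Rth (x ≺ y ⟷ x ⊕ Tone ≼ y)
| R_lt_add : Rth (x ≺ y ⟶ x ⊕ z ≺ y ⊕ z)
| R_lt_mul : Rth (x ≺ y ∧ ¬ (z ≐ Tzero) ⟶ x ⊗ z ≺ y ⊗ z)
| R_sub : Rth ((y ≼ x ⟶ (x ⊖ y) ⊕ y ≐ x) ∧ (x ≺ y ⟶ x ⊖ y ≐ Tzero))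
| R_div : Rth (((y ⊕ Tone) ⊗ Tdiv x y ≼ x)
               ∧ (x ⊖ (y ⊕ Tone) ⊗ Tdiv x y ≺ y ⊕ Tone)).

(** [C] is an R-conjunction of [A] and [B] when [Requiv C (A ∧ B)], and
    likewise for the other connectives. *)
Definition Requiv (A B : formula L) : Prop := Rth ⊢ (A ⟷ B).

End BaseTheory.

Arguments Rth {L} _.

(** * Term ideals *)

Section TermIdeals.
Variables (L : language) (B : theory L).
Implicit Types (s t r : term L) (TT : term L -> Prop).

Definition provably_in TT t : Prop := exists2 r, TT r & B ⊢ (t ≐ r).

Definition term_set TT : Prop :=
  [/\ provably_in TT Tzero /\ provably_in TT Tone,
      forall s t, TT s -> TT t ->
        [/\ provably_in TT (s ⊕ t), provably_in TT (s ⊖ t),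
            provably_in TT (s ⊗ t) & provably_in TT (Tdiv s t)]
    & forall t (y : nat) s, TT t -> provably_in TT (tsubst (upd y s) t)].

(** With n := tbound r, the two tuples of variables are 0, ..., n - 1 and
    n, ..., n + n - 1. *)
Definition monotone_term r : Prop :=
  let n := tbound r in
  B ⊢ (Fbigand [seq Tvar i ≼ Tvar (n + i) | i <- iota 0 n]
         ⟶ r ≼ tsubst (shift n) r).

Definition term_ideal TT : Prop :=
  term_set TT /\
  exists X : term L -> Prop,
    [/\ forall r, X r -> TT r,
        forall t, TT t -> exists2 s, X s & B ⊢ (t ≼ s)
      & forall r, X r -> monotone_term r].

End TermIdeals.

Definition T_all (L : language) : term L -> Prop := fun _ => True.
Arguments T_all {L} _.

(** * Classes of formulas *)

Section Classes.
Variable L : language.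
Implicit Types (A B C D H : formula L) (Phi Psi Pi : formula L -> Prop).

Definition bounded_class Psi : Prop := forall A, Psi A -> bounded A.

Definition contains_qf Psi : Prop := forall A, quantifier_free A -> Psi A.

Definition subst_closed Psi : Prop :=
  forall A (sigma : nat -> term L), Psi A -> Psi (fsubst sigma A).

Definition subformula_closed Psi : Prop :=
  forall A B, subformula A B -> Psi B -> Psi A.

Definition boolean_closed Psi : Prop :=
  (forall A, Psi A -> Psi (¬ A)) /\
  (forall A B, Psi A -> Psi B ->
     [/\ Psi (A ∧ B), Psi (A ∨ B) & Psi (A ⟶ B)]).

Definition in_class_R Psi A : Prop := exists2 A', Psi A' & Requiv A' A.

Definition pi_class Pi : Prop :=
  [/\ contains_qf Pi, subst_closed Pi & subformula_closed Pi] /\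
  [/\ forall A B, Pi A -> Pi B -> in_class_R Pi (A ∧ B),
      forall A B, Pi A -> Pi B -> in_class_R Pi (A ∨ B),
      forall (t : term L) A, Pi A -> in_class_R Pi (Ball t A)
    & forall (t : term L) B, Pi (Bex t B) ->
        in_class_R Pi (¬ B) /\ in_class_R Pi (¬ Ball t (¬ B))].

(** A block Q u_1 <= p_1 ... Q u_m <= p_m, possibly empty, is given by the list
    of its bounds; p_i lies in the scope of u_1, ..., u_{i-1}. *)
Definition balls (ps : seq (term L)) A : formula L := foldr (@Ball L) A ps.
Definition bexs (ps : seq (term L)) A : formula L := foldr (@Bex L) A ps.

Fixpoint Sigma_class Phi (k : nat) : formula L -> Prop :=
  match k with
  | 0 => Phi
  | k'.+1 => fun A => exists ps C, A = bexs ps C /\ Pi_class Phi k' C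
  end
with Pi_class Phi (k : nat) : formula L -> Prop :=
  match k with
  | 0 => Phi
  | k'.+1 => fun A => exists ps C, A = balls ps C /\ Sigma_class Phi k' C
  end.

(** * Bounded arithmetic *)

(** The induction variable is variable 0 of [A], and [t] is a term in that
    variable and in the parameters of [A]. *)
Definition induction_axiom A (t : term L) : formula L :=
  (fsubst (inst Tzero) A
     ∧ Fall (A ⟶ fsubst (upd 0 (Tvar 0 ⊕ Tone)) A))
  ⟶ Fall (fsubst (upd 0 t) A).

Inductive bounded_arithmetic (TT : term L -> Prop) Psi (Ax : theory L) :
    theory L :=
| BA_ax A : Ax A -> bounded_arithmetic TT Psi Ax A
| BA_ind A t : Psi A -> TT t ->
    bounded_arithmetic TT Psi Ax (induction_axiom A t).

(** * Deterministic reductions and flows *)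

(** The formula u_1 <= p_1 /\ ... /\ u_m <= p_m, in the scope of the whole
    block (in which u_m is variable 0). *)
Fixpoint block_bounds (ps : seq (term L)) : formula L :=
  match ps with
  | [::] => Ftop
  | p :: ps' =>
      (Tvar (size ps') ≼ tsubst (shift (size ps').+1) p) ∧ block_bounds ps'
  end.

(** Replaces a block of variables u_1, ..., u_m by the terms [fs] = f_1, ...,
    f_m, which live in the scope of another block of length [n]. *)
Definition block_subst (n : nat) (fs : seq (term L)) : nat -> term L :=
  fun i => if i < size fs then nth (Tvar 0) (rev fs) i
           else Tvar (n + (i - size fs)).

Variable B : theory L.

(** [dred Phi k Gamma F X Y] is the reduction of [X] to [Y] via F_1, ..., F_k,
    with the parameters subject to the hypotheses [Gamma]; F_i is the tuple of
    terms [F i], and only [F 1], ..., [F k] are used.  The guarded formulas of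
    the recursive step are replaced by R-equivalent members of the class. *)
Fixpoint dred Phi (k : nat) (Gamma : seq (formula L))
    (F : nat -> seq (term L)) (X Y : formula L) : Prop :=
  match k with
  | 0 => [/\ Phi X, Phi Y & prv B Gamma (X ⟶ Y)]
  | k'.+1 =>
      (exists ps qs C D X' Y',
        let m := size ps in let n := size qs in
        let Gamma' := map (fsubst (shift n)) Gamma in
        let sF := block_subst n (F k) in
        [/\ X = balls ps C /\ Sigma_class Phi k' C,
            Y = balls qs D /\ Sigma_class Phi k' D,
            size (F k) = m /\
              prv B Gamma' (block_bounds qs ⟶ fsubst sF (block_bounds ps)),
            [/\ Sigma_class Phi k' X', Sigma_class Phi k' Y',
                Requiv X' (fsubst sF (block_bounds ps) ⟶ fsubst sF C)
              & Requiv Y' (block_bounds qs ⟶ D)]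
          & dred Phi k' Gamma' F X' Y'])
      \/
      (exists ps qs C D X' Y',
        let m := size ps in let n := size qs in
        let Gamma' := map (fsubst (shift m)) Gamma in
        let sF := block_subst m (F k) in
        [/\ X = bexs ps C /\ Pi_class Phi k' C,
            Y = bexs qs D /\ Pi_class Phi k' D,
            size (F k) = n /\
              prv B Gamma' (block_bounds ps ⟶ fsubst sF (block_bounds qs)),
            [/\ Pi_class Phi k' X', Pi_class Phi k' Y',
                Requiv X' (block_bounds ps ∧ C)
              & Requiv Y' (fsubst sF (block_bounds qs) ∧ fsubst sF D)]
          & dred Phi k' Gamma' F X' Y'])
  end.

Definition dequiv Phi k Gamma (E0 E1 : nat -> seq (term L)) X Y : Prop :=
  dred Phi k Gamma E0 X Y /\ dred Phi k Gamma E1 Y X.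

(** In [H] the variable u is variable 0 and x_i is variable i + 1. *)
Definition dflow Phi (k : nat) (X Y : formula L) : Prop :=
  [/\ Pi_class Phi k X, Pi_class Phi k Y
    & exists (t : term L) H (E0 E1 G0 G1 F : nat -> seq (term L)),
      [/\ Pi_class Phi k H,
          dequiv Phi k [::] E0 E1 (fsubst (inst Tzero) H) X,
          dequiv Phi k [::] G0 G1 (fsubst (inst t) H) Y
        & dred Phi k [:: Tvar 0 ≺ tsubst (shift 1) t] F
            H (fsubst (upd 0 (Tvar 0 ⊕ Tone)) H)]].

Definition nflow (TT : term L -> Prop) Pi (X Y : formula L) : Prop :=
  [/\ Pi X, Pi Y
    & exists (t : term L) H,
      [/\ TT t /\ Pi H,
          B ⊢ (fsubst (inst Tzero) H ⟷ X),
          B ⊢ (fsubst (inst t) H ⟷ Y)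
        & B ⊢ (Fall (Tvar 0 ≺ tsubst (shift 1) t ⟶
                 (H ⟶ fsubst (upd 0 (Tvar 0 ⊕ Tone)) H)))]].

(** Flows between finite multisets of formulas of the class [Psi]: the
    conjunction and the disjunction are replaced by R-equivalent members of
    [Psi]. *)
Definition mflow Psi (flow : formula L -> formula L -> Prop)
    (Gamma Delta : seq (formula L)) : Prop :=
  [/\ forall A, List.In A Gamma -> Psi A,
      forall A, List.In A Delta -> Psi A
    & exists X Y,
      [/\ Psi X, Psi Y, Requiv X (Fbigand Gamma), Requiv Y (Fbigor Delta)
        & flow X Y]].

End Classes.

(* Main.v *)
(** A deterministic reduction is stronger than provable implication: a universal
    block of the target is introduced, the hypothesis is instantiated at the
    reduction terms, and dually for existential blocks; so by recursion on [k] a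
    deterministic flow is a non-deterministic one.  For a non-deterministic flow
    [H] of length [t], the induction axiom is applied to [H (u - (u - t))], where
    [u - (u - t)] is the minimum of [u] and [t].  This is a substitution instance
    of [H], hence in the class; its induction step is the flow step when [u < t]
    and trivial when [t <= u], and it is [H 0] at [0] and [H t] at [t]. *)

From Stdlib Require Import FunctionalExtensionality.
From Stdlib Require List.
Require Import Defs.
From mathcomp Require Import all_boot.

Set Implicit Arguments.
Unset Strict Implicit.
Unset Printing Implicit Defensive.

Local Open Scope fol_scope.

(** * Substitution calculus: composition, identity, and stability of the quantifier hierarchy *)

Section Substitution.
Variable L : language.
Implicit Types (s t : term L) (A : formula L) (sigma tau : nat -> term L).

Lemma tsubst_comp sigma tau t :
  tsubst tau (tsubst sigma t) = tsubst (fun i => tsubst tau (sigma i)) t.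
Proof.
elim: t => //= [t1 -> t2 ->|t1 -> t2 ->|t1 -> t2 ->|t1 -> t2 ->|f a IH] //.
by congr Tfun; apply: functional_extensionality.
Qed.

Lemma tsubst_id t : tsubst (@Tvar L) t = t.
Proof.
elim: t => //= [t1 -> t2 ->|t1 -> t2 ->|t1 -> t2 ->|t1 -> t2 ->|f a IH] //.
by congr Tfun; apply: functional_extensionality.
Qed.

(** Lets a substitution be altered beyond the finitely many variables of [t], as the renumbering of
    the tail in later instantiations requires. *)
Lemma eq_tsubst_bound sigma tau t :
  (forall i, i < tbound t -> sigma i = tau i) -> tsubst sigma t = tsubst tau t.
Proof.
elim: t => //= [n|t1 IH1 t2 IH2|t1 IH1 t2 IH2|t1 IH1 t2 IH2|t1 IH1 t2 IH2
    |f a IH] eq_st; first exact: eq_st.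
1-4: by rewrite IH1 ?IH2 // => i lt_i; apply: eq_st; rewrite leq_max lt_i ?orbT.
congr Tfun; apply: functional_extensionality => j; apply: IH => i lt_i.
by apply: eq_st; apply: leq_trans lt_i _; apply: (leq_bigmax j).
Qed.

Lemma shift0 : shift 0 = @Tvar L.
Proof. by []. Qed.

Lemma tsubst_shift_shift m n t :
  tsubst (shift m) (tsubst (shift n) t) = tsubst (shift (m + n)) t.
Proof.
rewrite tsubst_comp; congr tsubst; apply: functional_extensionality => i.
by rewrite /= /shift addnA.
Qed.

Lemma tsubst_shift_inst s t : tsubst (inst s) (tsubst (shift 1) t) = t.
Proof. by rewrite tsubst_comp -[RHS]tsubst_id. Qed.

Lemma up_comp sigma tau :
  (fun i => tsubst (up tau) (up sigma i))
    = up (fun i => tsubst tau (sigma i)).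
Proof. by apply: functional_extensionality => -[|i] //=; rewrite !tsubst_comp. Qed.

Lemma up_id : up (@Tvar L) = @Tvar L.
Proof. by apply: functional_extensionality => -[|i]. Qed.

Lemma fsubst_comp sigma tau A :
  fsubst tau (fsubst sigma A) = fsubst (fun i => tsubst tau (sigma i)) A.
Proof.
elim: A sigma tau => //= [t1 t2|t1 t2|r a|A IHA B IHB|A IHA B IHB|A IHA B IHB
    |A IHA|A IHA|t A IHA|t A IHA] sigma tau;
  rewrite ?tsubst_comp ?IHA ?IHB ?up_comp //.
by congr Frel; apply: functional_extensionality => i; rewrite tsubst_comp.
Qed.

Lemma fsubst_id A : fsubst (@Tvar L) A = A.
Proof.
elim: A => //= [t1 t2|t1 t2|r a|A IHA B IHB|A IHA B IHB|A IHA B IHB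
    |A IHA|A IHA|t A IHA|t A IHA];
  rewrite ?tsubst_id ?up_id ?IHA ?IHB //.
by congr Frel; apply: functional_extensionality => i; rewrite tsubst_id.
Qed.

Lemma fsubst_shift_shift m n A :
  fsubst (shift m) (fsubst (shift n) A) = fsubst (shift (m + n)) A.
Proof.
rewrite fsubst_comp; congr fsubst; apply: functional_extensionality => i.
by rewrite /= /shift addnA.
Qed.

Lemma up_inst sigma s :
  (fun i => tsubst (inst s) (up sigma i))
    = (fun i => if i is j.+1 then sigma j else s).
Proof.
by apply: functional_extensionality => -[|i] //=; rewrite tsubst_shift_inst.
Qed.

(** The equality rule speaks of [inst]; moving the other variables up by one frees variable 0 as the
    hole, so [s] may itself mention the old variable 0. *)
Lemma fsubst_upd0 s A :
  fsubst (upd 0 s) A = fsubst (inst s) (fsubst (up (shift 1)) A).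
Proof.
rewrite fsubst_comp up_inst; congr fsubst.
by apply: functional_extensionality => -[|i].
Qed.

Lemma fsubst_balls sigma ps A :
  exists qs tau, fsubst sigma (balls ps A) = balls qs (fsubst tau A).
Proof.
elim: ps sigma => [|p ps IH] sigma; first by exists [::], sigma.
by have [qs [tau /= ->]] := IH (up sigma); exists (tsubst sigma p :: qs), tau.
Qed.

Lemma fsubst_bexs sigma ps A :
  exists qs tau, fsubst sigma (bexs ps A) = bexs qs (fsubst tau A).
Proof.
elim: ps sigma => [|p ps IH] sigma; first by exists [::], sigma.
by have [qs [tau /= ->]] := IH (up sigma); exists (tsubst sigma p :: qs), tau.
Qed.

(** A substitution pushed below a quantifier block changes bounds and matrix but not the shape. The
    two classes alternate, hence the simultaneous induction. *)
Lemma hierarchy_subst_closed (Phi : formula L -> Prop) k :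
  subst_closed Phi ->
  subst_closed (Sigma_class Phi k) /\ subst_closed (Pi_class Phi k).
Proof.
move=> PhiS; elim: k => //= k [IHS IHP]; split=> _ sigma [ps [C [-> CP]]].
  have [qs [tau ->]] := fsubst_bexs sigma ps C.
  by exists qs, (fsubst tau C); split=> //; apply: IHP.
have [qs [tau ->]] := fsubst_balls sigma ps C.
by exists qs, (fsubst tau C); split=> //; apply: IHS.
Qed.

End Substitution.

(** * Structural rules, case distinction and substitution into theorems *)

Section Provability.
Variable L : language.
Implicit Types (T : theory L) (s t : term L) (A C : formula L)
  (Gamma : seq (formula L)) (sigma tau : nat -> term L).

Lemma incl_consS A Gamma Gamma' :
  List.incl Gamma Gamma' -> List.incl (A :: Gamma) (A :: Gamma').
Proof.
move=> sub; apply: List.incl_cons; first exact: List.in_eq.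
exact: List.incl_tl.
Qed.

Lemma prv_weaken T Gamma Gamma' A :
  List.incl Gamma Gamma' -> prv T Gamma A -> prv T Gamma' A.
Proof.
move=> + prA; elim: prA Gamma' => {Gamma A}.
- by move=> Gamma A TA *; apply: prv_ax.
- by move=> Gamma A inA Gamma' sub; apply/prv_hyp/sub.
- by move=> Gamma A _ IH Gamma' sub; apply/prv_raa/IH/incl_consS.
- by move=> Gamma A B _ IHA _ IHB Gamma' sub; apply: prv_andI; eauto.
- by move=> Gamma A B _ IH Gamma' /IH; apply: prv_andE1.
- by move=> Gamma A B _ IH Gamma' /IH; apply: prv_andE2.
- by move=> Gamma A B _ IH Gamma' /IH; apply: prv_orI1.
- by move=> Gamma A B _ IH Gamma' /IH; apply: prv_orI2.
- move=> Gamma A B C _ IH _ IHA _ IHB Gamma' sub.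
  by apply: prv_orE (IH _ sub) _ _; [apply: IHA|apply: IHB]; apply: incl_consS.
- by move=> Gamma A B _ IH Gamma' sub; apply/prv_impI/IH/incl_consS.
- by move=> Gamma A B _ IHAB _ IHA Gamma' sub; apply: prv_impE; eauto.
- by move=> Gamma A _ IH Gamma' sub; apply/prv_allI/IH/List.incl_map.
- by move=> Gamma A s _ IH Gamma' /IH; apply: prv_allE.
- by move=> Gamma A s _ IH Gamma' /IH; apply: prv_exI.
- move=> Gamma A C _ IH _ IHC Gamma' sub; apply: prv_exE (IH _ sub) _.
  exact/IHC/incl_consS/List.incl_map.
- move=> Gamma t A _ IH Gamma' sub; apply/prv_ballI/IH.
  exact/incl_consS/List.incl_map.
- by move=> Gamma t A s _ IH _ IHs Gamma' sub; apply: prv_ballE; eauto.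
- by move=> Gamma t A s _ IHs _ IH Gamma' sub; apply: prv_bexI; eauto.
- move=> Gamma t A C _ IH _ IHC Gamma' sub; apply: prv_bexE (IH _ sub) _.
  exact/IHC/incl_consS/incl_consS/List.incl_map.
- by move=> *; apply: prv_eqI.
- by move=> Gamma A s t _ IHs _ IHA Gamma' sub; apply: prv_eqE; eauto.
Qed.

Lemma prv_nil T Gamma A : T ⊢ A -> prv T Gamma A.
Proof. exact/prv_weaken/List.incl_nil_l. Qed.

Lemma prv_wk T Gamma A C : prv T Gamma C -> prv T (A :: Gamma) C.
Proof. exact/prv_weaken/List.incl_tl/List.incl_refl. Qed.

Lemma prv_hyp0 T Gamma A : prv T (A :: Gamma) A.
Proof. exact/prv_hyp/List.in_eq. Qed.

Lemma prv_cut T Gamma A C :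
  prv T Gamma A -> prv T (A :: Gamma) C -> prv T Gamma C.
Proof. by move=> prA prC; apply: prv_impE prA; apply: prv_impI. Qed.

Lemma prv_efq T Gamma A : prv T Gamma Fbot -> prv T Gamma A.
Proof. by move=> prF; apply/prv_raa/prv_wk. Qed.

Lemma prv_em T Gamma A : prv T Gamma (A ∨ ¬ A).
Proof.
apply: prv_raa; apply: (@prv_impE _ _ _ (A ∨ ¬ A)); first exact: prv_hyp0.
apply: prv_orI2; apply: prv_impI.
apply: (@prv_impE _ _ _ (A ∨ ¬ A)); first exact/prv_wk/prv_hyp0.
exact/prv_orI1/prv_hyp0.
Qed.

Lemma prv_case T Gamma A C :
  prv T (A :: Gamma) C -> prv T ((¬ A) :: Gamma) C -> prv T Gamma C.
Proof. exact/prv_orE/prv_em. Qed.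

(** Used right after a generalization: shifting a universal hypothesis and instantiating it at the
    fresh variable 0 gives back its body. *)
Lemma prv_all_var0 T A : prv T [:: fsubst (shift 1) (Fall A)] A.
Proof.
have := prv_allE (Tvar 0) (@prv_hyp0 T [::] (Fall (fsubst (up (shift 1)) A))).
rewrite fsubst_comp up_inst; congr prv; rewrite -[RHS]fsubst_id.
by congr fsubst; apply: functional_extensionality => -[|i].
Qed.

(* The free variables from [n] on are renumbered, because each of the [n]
   generalizations followed by an instantiation consumes variable 0. *)
Lemma prv_subst_prefix T A sigma n : T ⊢ A ->
  T ⊢ fsubst (fun i => if i < n then sigma i else Tvar (i - n)) A.
Proof.
elim: n A sigma => [|n IH] A sigma prA.
  suff -> : (fun i => if i < 0 then sigma i else Tvar (i - 0)) = @Tvar L.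
    by rewrite fsubst_id.
  by apply: functional_extensionality => i; rewrite subn0.
(* The shift by [n] protects [sigma 0] from the remaining [n] instantiations, which lower its
   variables by [n] again. *)
have := prv_allE (tsubst (shift n) (sigma 0)) (@prv_allI _ T [::] A prA).
move/IH=> /(_ (fun i => sigma i.+1)).
rewrite fsubst_comp; congr (prv _ _ (fsubst _ _)).
apply: functional_extensionality => -[|i] //=.
rewrite tsubst_comp -[RHS]tsubst_id; congr tsubst.
apply: functional_extensionality => i /=.
by rewrite ltnNge leq_addr /= addKn.
Qed.

(** With a prefix long enough to cover both terms, the prefix substitution agrees with [sigma] on
    them. *)
Lemma prv_eq_subst T s t sigma :
  T ⊢ (s ≐ t) -> T ⊢ (tsubst sigma s ≐ tsubst sigma t).
Proof.
move=> /(@prv_subst_prefix _ _ sigma (maxn (tbound s) (tbound t))) /=.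
by congr (prv _ _ (_ ≐ _)); apply: eq_tsubst_bound => i lt_i;
  rewrite leq_max lt_i ?orbT.
Qed.

End Provability.

(** * Congruence rules for equality *)

Section Equality.
Variables (L : language) (T : theory L) (Gamma : seq (formula L)).
Implicit Types (a b c d : term L).
Local Notation "|- A" := (prv T Gamma A) (at level 99).

(** Here [c] is a context with hole 0. In the rewritten formula the left side is shifted, so only
    the right side is rewritten, starting from reflexivity. *)
Lemma eq_tm a b c : (|- a ≐ b) ->
  |- tsubst (inst a) c ≐ tsubst (inst b) c.
Proof.
move=> eab; have := @prv_eqE _ T Gamma
  (tsubst (shift 1) (tsubst (inst a) c) ≐ c) _ _ eab.
by rewrite /= !tsubst_shift_inst; apply; apply: prv_eqI.
Qed.

Lemma prv_eq_sym a b : (|- a ≐ b) -> |- b ≐ a.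
Proof.
move=> eab; have := @prv_eqE _ T Gamma (Tvar 0 ≐ tsubst (shift 1) a) _ _ eab.
by rewrite /= !tsubst_shift_inst; apply; apply: prv_eqI.
Qed.

Lemma prv_eq_trans a b c : (|- a ≐ b) -> (|- b ≐ c) -> |- a ≐ c.
Proof.
move=> eab ebc; have := @prv_eqE _ T Gamma (tsubst (shift 1) a ≐ Tvar 0) _ _ ebc.
by rewrite /= !tsubst_shift_inst; apply.
Qed.

Lemma eq_add a b c d : (|- a ≐ b) -> (|- c ≐ d) -> |- a ⊕ c ≐ b ⊕ d.
Proof.
move=> /(@eq_tm _ _ (Tvar 0 ⊕ tsubst (shift 1) c)) + /(@eq_tm _ _ (tsubst (shift 1) b ⊕ Tvar 0)).
by rewrite /= !tsubst_shift_inst; apply: prv_eq_trans.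
Qed.

Lemma eq_le a b c d : (|- a ≐ b) -> (|- c ≐ d) -> (|- a ≼ c) -> |- b ≼ d.
Proof.
move=> eab ecd ac; have := @prv_eqE _ T Gamma (Tvar 0 ≼ tsubst (shift 1) c) _ _ eab.
have := @prv_eqE _ T Gamma (tsubst (shift 1) b ≼ Tvar 0) _ _ ecd.
by rewrite /= !tsubst_shift_inst; move=> h1 h2; apply/h1/h2.
Qed.

Lemma eq_lt a b c d : (|- a ≐ b) -> (|- c ≐ d) -> (|- a ≺ c) -> |- b ≺ d.
Proof.
move=> eab ecd ac; have := @prv_eqE _ T Gamma (Tvar 0 ≺ tsubst (shift 1) c) _ _ eab.
have := @prv_eqE _ T Gamma (tsubst (shift 1) b ≺ Tvar 0) _ _ ecd.
by rewrite /= !tsubst_shift_inst; move=> h1 h2; apply/h1/h2.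
Qed.

End Equality.

(** * Arithmetic in the base theory, up to the minimum of two terms *)

Section Arithmetic.
Variables (L : language) (T : theory L).
Hypothesis RT : subtheory Rth T.
Implicit Types (a b c x y z : term L) (Gamma : seq (formula L)).

(** The axioms use variables 0, 1, 2 only, so a prefix of length 3 suffices; an axiom with fewer
    variables receives an arbitrary filler. *)
Lemma R_inst A Gamma x y z : Rth A ->
  prv T Gamma (fsubst (fun i => if i < 3 then nth Tzero [:: x; y; z] i
                                else Tvar (i - 3)) A).
Proof. by move=> RA; apply/prv_nil/prv_subst_prefix/RT/prv_ax. Qed.

Lemma R_discrete_le Gamma a b :
  prv T Gamma (a ≺ b) -> prv T Gamma (a ⊕ Tone ≼ b).
Proof. exact/prv_impE/prv_andE1/(@R_inst _ _ a b a (R_discrete _)). Qed.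

Lemma prv_le_anti Gamma a b :
  prv T Gamma (a ≼ b) -> prv T Gamma (b ≼ a) -> prv T Gamma (a ≐ b).
Proof.
move=> ab ba; apply: prv_impE (@R_inst _ _ a b a (R_le_anti _)) _.
exact: prv_andI.
Qed.

Lemma prv_le_trans Gamma a b c :
  prv T Gamma (a ≼ b) -> prv T Gamma (b ≼ c) -> prv T Gamma (a ≼ c).
Proof.
move=> ab bc; apply: prv_impE (@R_inst _ _ a b c (R_le_trans _)) _.
exact: prv_andI.
Qed.

Lemma prv_le_refl Gamma a : prv T Gamma (a ≼ a).
Proof. exact: (@R_inst _ _ a a a (R_le_refl _)). Qed.

Lemma eq_leq Gamma a b : prv T Gamma (a ≐ b) -> prv T Gamma (a ≼ b).
Proof. by move=> ab; apply: eq_le (prv_eqI _ _ _) ab (prv_le_refl _ _). Qed.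

Lemma le_cases Gamma a b C :
  prv T ((a ≼ b) :: Gamma) C -> prv T ((b ≼ a) :: Gamma) C -> prv T Gamma C.
Proof. exact/prv_orE/(@R_inst _ _ a b a (R_le_total _)). Qed.

Lemma lt_anti Gamma a b C :
  prv T Gamma (a ≺ b) -> prv T Gamma (b ≼ a) -> prv T Gamma C.
Proof.
move=> ab ba; apply: prv_efq; apply: prv_impE (prv_andE2 ab) _.
exact: prv_le_anti (prv_andE1 ab) ba.
Qed.

Lemma lt_cases Gamma a b C :
  prv T ((a ≺ b) :: Gamma) C -> prv T ((b ≼ a) :: Gamma) C -> prv T Gamma C.
Proof.
move=> hlt hge; apply: (@le_cases _ a b) (hge).
apply: (@prv_case _ _ _ (a ≐ b)).
  apply: prv_cut (prv_weaken _ hge); first exact/eq_leq/prv_eq_sym/prv_hyp0.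
  exact/incl_consS/List.incl_tl/List.incl_tl/List.incl_refl.
apply: prv_cut (prv_weaken _ hlt).
  exact: prv_andI (prv_wk _ (prv_hyp0 _ _ _)) (prv_hyp0 _ _ _).
exact/incl_consS/List.incl_tl/List.incl_tl/List.incl_refl.
Qed.

Lemma lt_add Gamma a b c :
  prv T Gamma (a ≺ b) -> prv T Gamma (a ⊕ c ≺ b ⊕ c).
Proof. exact/prv_impE/(@R_inst _ _ a b c (R_lt_add _)). Qed.

Lemma lt_mul Gamma a b c :
  prv T Gamma (a ≺ b) -> prv T Gamma (¬ (c ≐ Tzero)) ->
  prv T Gamma (a ⊗ c ≺ b ⊗ c).
Proof.
move=> ab c0; apply: prv_impE (@R_inst _ _ a b c (R_lt_mul _)) _.
exact: prv_andI.
Qed.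

Lemma sub_add Gamma a b :
  prv T Gamma (b ≼ a) -> prv T Gamma ((a ⊖ b) ⊕ b ≐ a).
Proof. exact/prv_impE/prv_andE1/(@R_inst _ _ a b a (R_sub _)). Qed.

Lemma sub_lt0 Gamma a b :
  prv T Gamma (a ≺ b) -> prv T Gamma (a ⊖ b ≐ Tzero).
Proof. exact/prv_impE/prv_andE2/(@R_inst _ _ a b a (R_sub _)). Qed.

Lemma addC Gamma a b : prv T Gamma (a ⊕ b ≐ b ⊕ a).
Proof. exact: (@R_inst _ _ a b a (R_addC _)). Qed.

Lemma add0 Gamma a : prv T Gamma (a ⊕ Tzero ≐ a).
Proof. exact: (@R_inst _ _ a a a (R_add0 _)). Qed.

Lemma add0l Gamma a : prv T Gamma (Tzero ⊕ a ≐ a).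
Proof. exact: prv_eq_trans (addC _ _ _) (add0 _ _). Qed.

Lemma mulC Gamma a b : prv T Gamma (a ⊗ b ≐ b ⊗ a).
Proof. exact: (@R_inst _ _ a b a (R_mulC _)). Qed.

Lemma mul0 Gamma a : prv T Gamma (a ⊗ Tzero ≐ Tzero).
Proof. exact: (@R_inst _ _ a a a (R_mul0 _)). Qed.

Lemma mulD Gamma a b c : prv T Gamma (a ⊗ (b ⊕ c) ≐ a ⊗ b ⊕ a ⊗ c).
Proof. exact: (@R_inst _ _ a b c (R_mulD _)). Qed.

(* A negative [x] has the additive inverse [n = 0 - x], which is positive; then
   [x * x < 0] while [x * n < 0] gives [0 = x * n + x * x < x * x]. *)
Lemma le0 Gamma x : prv T Gamma (Tzero ≼ x).
Proof.
apply: (@lt_cases _ x Tzero); last exact: prv_hyp0.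
set G := _ :: _; have x_lt0 : prv T G (x ≺ Tzero) by apply: prv_hyp0.
pose n := Tzero ⊖ x.
have nx : prv T G (n ⊕ x ≐ Tzero) by apply/sub_add/prv_andE1/x_lt0.
have n_gt0 : prv T G (Tzero ≺ n).
  apply: eq_lt (lt_add n x_lt0); last exact: add0l.
  exact: prv_eq_trans (addC _ _ _) nx.
have n_neq0 : prv T G (¬ (n ≐ Tzero)).
  apply: prv_impI; apply: prv_impE (prv_andE2 (prv_wk _ n_gt0)) _.
  exact/prv_eq_sym/prv_hyp0.
have lt0_mul c : prv T G (¬ (c ≐ Tzero)) -> prv T G (x ⊗ c ≺ Tzero).
  move=> c0; apply: eq_lt (lt_mul x_lt0 c0); first exact: prv_eqI.
  exact: prv_eq_trans (mulC _ _ _) (mul0 _ _).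
have xx_gt0 : prv T G (Tzero ≺ x ⊗ x).
  apply: eq_lt (lt_add (x ⊗ x) (lt0_mul _ n_neq0)); last exact: add0l.
  apply: prv_eq_trans (prv_eq_sym (mulD _ _ _ _)) _.
  apply: prv_eq_trans (mul0 _ x).
  have := @eq_tm _ T G _ _ (tsubst (shift 1) x ⊗ Tvar 0) nx.
  by rewrite /= !tsubst_shift_inst.
apply: lt_anti xx_gt0 (prv_andE1 (lt0_mul _ _)).
exact: prv_andE2 x_lt0.
Qed.

(** Either [b] is zero, or it is positive by [le0] and strict monotonicity of addition applies. *)
Lemma le_addr Gamma a b : prv T Gamma (a ≼ b ⊕ a).
Proof.
apply: (@prv_case _ _ _ (Tzero ≐ b)).
  apply: eq_leq; apply: prv_eq_trans (prv_eq_sym (add0l _ _)) _.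
  exact: eq_add (prv_hyp0 _ _ _) (prv_eqI _ _ _).
apply: eq_le (add0l _ a) (prv_eqI _ _ _) (prv_andE1 (lt_add _ _)).
exact: prv_andI (le0 _ _) (prv_hyp0 _ _ _).
Qed.

(** If [a] and [b] were strictly ordered either way, adding [c] would keep the order strict. *)
Lemma add_inj Gamma a b c :
  prv T Gamma (a ⊕ c ≐ b ⊕ c) -> prv T Gamma (a ≐ b).
Proof.
move=> eac; apply: (@lt_cases _ a b).
  apply: lt_anti (lt_add c (prv_hyp0 _ _ _)) _.
  exact/eq_leq/prv_eq_sym/prv_wk.
apply: (@lt_cases _ b a).
  apply: lt_anti (lt_add c (prv_hyp0 _ _ _)) _.
  by apply: eq_leq; do 2! apply: prv_wk.
exact: prv_le_anti (prv_hyp0 _ _ _) (prv_wk _ (prv_hyp0 _ _ _)).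
Qed.

Definition tmin a b : term L := a ⊖ (a ⊖ b).

(** Adding [a ⊖ b] to either side gives [a], and addition cancels. *)
Lemma tmin_r Gamma a b : prv T Gamma (b ≼ a) -> prv T Gamma (tmin a b ≐ b).
Proof.
move=> ba; apply: (@add_inj _ _ _ (a ⊖ b)).
apply: prv_eq_trans (sub_add _) _.
  apply: eq_le (prv_eqI _ _ _) (sub_add ba) _.
  exact: eq_le (prv_eqI _ _ _) (addC _ _ _) (le_addr _ _ _).
exact: prv_eq_trans (prv_eq_sym (sub_add ba)) (addC _ _ _).
Qed.

Lemma tmin_l Gamma a b : prv T Gamma (a ≼ b) -> prv T Gamma (tmin a b ≐ a).
Proof.
(* The axiom for subtraction gives value zero only when [a ≺ b]; otherwise [a] and [b] coincide and
   [tmin_r] applies. *)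
move=> ab; apply: (@lt_cases _ a b); last first.
  apply: prv_eq_trans (tmin_r (prv_hyp0 _ _ _)) _.
  exact: prv_le_anti (prv_hyp0 _ _ _) (prv_wk _ ab).
have sub0 : prv T ((a ≺ b) :: Gamma) (a ⊖ b ≐ Tzero) := sub_lt0 (prv_hyp0 _ _ _).
apply: prv_eq_trans (prv_eq_sym (add0 _ _)) _.
apply: prv_eq_trans (eq_add (prv_eqI _ _ _) (prv_eq_sym sub0)) _.
exact/sub_add/(eq_le (prv_eq_sym sub0) (prv_eqI _ _ _) (le0 _ _)).
Qed.

End Arithmetic.

(** * Introduction and elimination rules for blocks of bounded quantifiers *)

Section Blocks.
Variables (L : language) (T : theory L).
Implicit Types (p s t : term L) (ps qs fs : seq (term L)) (A C G : formula L)
  (Gamma : seq (formula L)) (sigma tau : nat -> term L).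

(* [block_inst (shift n) fs] is [block_subst n fs]. *)
Definition block_inst tau fs : nat -> term L :=
  fun i => if i < size fs then nth (Tvar 0) (rev fs) i else tau (i - size fs).

Lemma block_inst_nil tau : block_inst tau [::] = tau.
Proof.
by apply: functional_extensionality => i; rewrite /block_inst /= subn0.
Qed.

(** The first variable of a block is the outermost one and has the largest index; peeling off its
    term therefore extends [tau] at 0. *)
Lemma block_inst_cons tau f fs :
  block_inst tau (f :: fs)
    = block_inst (fun i => if i is j.+1 then tau j else f) fs.
Proof.
apply: functional_extensionality => i; rewrite /block_inst /= rev_cons ltnS.
rewrite nth_rcons size_rev; case: ltngtP => [//|lt_i|->]; last by rewrite subnn.
by rewrite -[i - size fs]prednK ?subn_gt0 //= subnS.
Qed.

Lemma block_inst_shift tau fs p :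
  tsubst (block_inst tau fs) (tsubst (shift (size fs)) p) = tsubst tau p.
Proof.
rewrite tsubst_comp; congr tsubst; apply: functional_extensionality => i /=.
by rewrite /block_inst ltnNge leq_addr /= addKn.
Qed.

Lemma block_inst_head tau f fs : block_inst tau (f :: fs) (size fs) = f.
Proof. by rewrite block_inst_cons /block_inst ltnn subnn. Qed.

(** The quantifiers are opened one by one; each bound is shifted past the variables opened after it
    and then joined to the conjunction [block_bounds]. *)
Lemma prv_ballsI Gamma qs A :
  prv T (block_bounds qs :: map (fsubst (shift (size qs))) Gamma) A ->
  prv T Gamma (balls qs A).
Proof.
elim: qs Gamma => [|q qs IH] Gamma /= prA.
  move: prA; rewrite shift0 (eq_map (@fsubst_id L)) map_id.
  exact/prv_cut/prv_impI/prv_hyp0.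
apply/prv_ballI/IH => /=; rewrite tsubst_shift_shift addn1 {1}/shift addn0.
rewrite -map_comp (eq_map (fsubst_shift_shift (size qs) 1)) addn1.
apply: prv_cut (prv_weaken _ prA).
  by apply: prv_andI (prv_hyp0 _ _ _); apply/prv_wk/prv_hyp0.
exact/incl_consS/List.incl_tl/List.incl_tl/List.incl_refl.
Qed.

Lemma prv_bexsE Gamma ps A G :
  prv T Gamma (bexs ps A) ->
  prv T (A :: block_bounds ps :: map (fsubst (shift (size ps))) Gamma)
    (fsubst (shift (size ps)) G) ->
  prv T Gamma G.
Proof.
elim: ps Gamma G => [|p ps IH] Gamma G /= prE prG.
  move: prG; rewrite shift0 fsubst_id (eq_map (@fsubst_id L)) map_id => prG.
  apply: prv_cut prE (prv_cut (prv_impI (prv_hyp0 _ _ _)) _).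
  apply: prv_weaken prG => B [<-|[<-|]] /=; by [right; left|left|right; right].
apply: prv_bexE prE _; apply: IH; first exact: prv_hyp0.
rewrite fsubst_shift_shift addn1 /= tsubst_shift_shift addn1.
have -> : shift (size ps) 0 = @Tvar L (size ps) by rewrite /shift addn0.
rewrite -map_comp (eq_map (fsubst_shift_shift (size ps) 1)) addn1.
set bps := block_bounds ps in prG *; set bp := Fle _ _ in prG *.
apply: (@prv_cut _ _ _ (bp ∧ bps)).
  by apply: prv_andI; apply: prv_hyp => /=; tauto.
by apply: prv_weaken prG => B /=; tauto.
Qed.

(** The induction needs an arbitrary [tau]: once the first variable has its term, the rest of the
    block stands under [tau] extended by that term. *)
Lemma prv_ballsE Gamma tau fs ps A :
  size fs = size ps ->
  prv T Gamma (fsubst tau (balls ps A)) ->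
  prv T Gamma (fsubst (block_inst tau fs) (block_bounds ps)) ->
  prv T Gamma (fsubst (block_inst tau fs) A).
Proof.
elim: ps tau fs => [|p ps IH] tau [|f fs] //=; first by rewrite block_inst_nil.
move=> [sz] prA prb; move: (prv_andE1 prb) (prv_andE2 prb) => /=.
rewrite -sz block_inst_head (block_inst_shift tau (f :: fs)) block_inst_cons => le_f prbs.
apply: IH => //; move: (prv_ballE prA le_f).
by rewrite fsubst_comp up_inst.
Qed.

Lemma prv_bexsI Gamma tau fs ps A :
  size fs = size ps ->
  prv T Gamma (fsubst (block_inst tau fs) (block_bounds ps)) ->
  prv T Gamma (fsubst (block_inst tau fs) A) ->
  prv T Gamma (fsubst tau (bexs ps A)).
Proof.
elim: ps tau fs => [|p ps IH] tau [|f fs] //=; first by rewrite block_inst_nil.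
move=> [sz] prb; move: (prv_andE1 prb) (prv_andE2 prb) => /=.
rewrite -sz block_inst_head (block_inst_shift tau (f :: fs)) block_inst_cons.
move=> le_f prbs prA; apply: prv_bexI le_f _.
by rewrite fsubst_comp up_inst; apply: IH sz prbs prA.
Qed.

End Blocks.

(** * Soundness of reductions and flows *)

Section Flows.
Variable L : language.
Implicit Types (T B : theory L) (A C X Y H : formula L)
  (Gamma : seq (formula L)).

Lemma Requiv_prv T Gamma A C : subtheory Rth T -> Requiv A C ->
  prv T Gamma (A ⟶ C) /\ prv T Gamma (C ⟶ A).
Proof.
move=> RT /RT/(@prv_nil _ _ Gamma) eqAC.
by split; [apply: prv_andE1 eqAC|apply: prv_andE2 eqAC].
Qed.

(** [Gamma] varies in the induction on [k], because each level shifts it past a block. The guards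
    supply the block bounds under which the bodies are compared. *)
Lemma dred_sound B Phi k Gamma F X Y : subtheory Rth B ->
  dred B Phi k Gamma F X Y -> prv B Gamma (X ⟶ Y).
Proof.
move=> RB; elim: k Gamma F X Y => [|k IH] Gamma F X Y /=; first by case.
case=> [] [ps [qs [C [D [X' [Y' [[-> _] [-> _] [sz bnd] [_ _ eqX eqY]]]]]]]] /IH.
- move=> prXY; apply/prv_impI/prv_ballsI => /=.
  apply: prv_impE (prv_hyp0 _ _ _).
  apply: prv_impE (Requiv_prv _ RB eqY).1 _; apply: prv_wk.
  apply: prv_impE (prv_wk _ prXY) _.
  apply: prv_impE (Requiv_prv _ RB eqX).2 _; apply: prv_impI.
  by apply: prv_ballsE sz (prv_wk _ (prv_hyp0 _ _ _)) (prv_hyp0 _ _ _).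
- move=> prXY; apply/prv_impI/(prv_bexsE (prv_hyp0 _ _ _)) => /=.
  set G := _ :: _.
  have prb : prv B G (block_bounds ps) by apply/prv_wk/prv_hyp0.
  apply: prv_bexsI sz _ _.
    by apply: prv_impE prb; do 3! apply: prv_wk.
  apply/prv_andE2/(prv_impE (Requiv_prv _ RB eqY).1).
  have /prv_impE : prv B G (X' ⟶ Y') by do 3! apply: prv_wk.
  apply; apply: prv_impE (Requiv_prv _ RB eqX).2 _.
  exact: prv_andI prb (prv_hyp0 _ _ _).
Qed.

Lemma dflow_nflow B Phi k X Y : subtheory Rth B ->
  dflow B Phi k X Y -> nflow B T_all (Pi_class Phi k) X Y.
Proof.
move=> RB [PX PY [t [H [E0 [E1 [G0 [G1 [F [PH [e0 e1] [g0 g1] step]]]]]]]]].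
split=> //; exists t, H; split=> //.
- exact: prv_andI (dred_sound RB e0) (dred_sound RB e1).
- exact: prv_andI (dred_sound RB g0) (dred_sound RB g1).
- exact/prv_allI/prv_impI/(dred_sound RB step).
Qed.

(* Shifting is the composition of the replacements of [Tvar j] by [Tvar j.+1],
   performed from the largest [j] down to 0. *)
Lemma term_set_shift B (TT : term L -> Prop) t :
  term_set B TT -> TT t -> provably_in B TT (tsubst (shift 1) t).
Proof.
case=> _ _ closed TTt.
pose skip j : nat -> term L := fun i => if i < j then Tvar i else Tvar i.+1.
have skip_in d : provably_in B TT (tsubst (skip (tbound t - d)) t).
  elim: d => [|d [r TTr eq_r]].
    exists t => //; suff -> : tsubst (skip (tbound t - 0)) t = t.
      exact: prv_eqI.
    rewrite -[RHS]tsubst_id; apply: eq_tsubst_bound => i lt_i.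
    by rewrite /skip subn0 lt_i.
  (* Once [d] reaches [tbound t], the truncated difference stays 0 and nothing changes. *)
  have [le_d|lt_d] := leqP (tbound t) d.
    rewrite (eqP (leqW le_d : tbound t - d.+1 == 0)).
    by rewrite -(eqP (le_d : tbound t - d == 0)); exists r.
  set j := tbound t - d.+1; have ej : tbound t - d = j.+1 by rewrite /j subnSK.
  (* The image of [skip j.+1] omits index [j.+1], so moving [Tvar j] there yields exactly
     [skip j]. *)
  have [r' TTr' eq_r'] := closed r j (Tvar j.+1) TTr.
  exists r' => //; apply: prv_eq_trans eq_r'.
  have := prv_eq_subst (upd j (Tvar j.+1)) eq_r.
  rewrite tsubst_comp ej; congr (prv _ _ (tsubst _ _ ≐ _)).
  apply: functional_extensionality => i; rewrite /skip ltnS leq_eqVlt.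
  have [->|ne_i] := eqVneq i j; first by rewrite ltnn /= /upd eqxx.
  rewrite /=; case: ltnP => [_|le_i] /=; rewrite /upd ?(negbTE ne_i) //.
  by rewrite gtn_eqF // ltnS.
by have := skip_in (tbound t); rewrite subnn; congr provably_in.
Qed.

Lemma bounded_arithmetic_sub (TT : term L -> Prop) Pi T A :
  T ⊢ A -> bounded_arithmetic TT Pi T ⊢ A.
Proof.
move=> prA.
suff gen Gamma C : prv T Gamma C -> prv (bounded_arithmetic TT Pi T) Gamma C.
  exact: gen.
elim=> {Gamma C}; eauto using prv.
by move=> Gamma C TC; apply/prv_ax/BA_ax.
Qed.

(* Induction on [u] for [H (tmin u t)]: unlike [u <= t -> H u], this formula is
   a substitution instance of [H]. *)
Lemma nflow_sound (A B : theory L) (TT : term L -> Prop) Pi X Y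
    (M := bounded_arithmetic TT Pi A) :
  subtheory Rth A -> term_set A TT -> subst_closed Pi -> subtheory B M ->
  nflow B TT Pi X Y -> M ⊢ (X ⟶ Y).
Proof.
move=> RA TTset PiS BM [_ _ [t [H [[TTt PiH] /BM HX /BM HY /BM Hstep]]]].
have RM : subtheory Rth M by move=> C /RA; apply: bounded_arithmetic_sub.
(* The term of an induction axiom lives in the scope of the induction variable, so [t] is needed in
   shifted form; closure of [TT] provides this up to provable equality, as [r]. *)
have [r TTr /(bounded_arithmetic_sub TT Pi) eq_r] := term_set_shift TTset TTt.
set t1 := tsubst (shift 1) t in eq_r Hstep.
(* In [H1] variable 0 is a hole and the induction variable is index 1, so equality can replace the
   argument of [H] by terms in that variable. *)
pose H1 := fsubst (up (shift 1)) H.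
pose K := fsubst (upd 0 (tmin (Tvar 0) t1)) H.
have K_inst s : fsubst (inst s) K = fsubst (inst (tmin s t)) H.
  rewrite fsubst_comp; congr fsubst.
  apply: functional_extensionality => -[|i] //=.
  by rewrite /t1 tsubst_shift_inst.
have H1_inst s : fsubst (inst s) H1 = fsubst (upd 0 s) H by rewrite fsubst_upd0.
have H1_var0 : fsubst (inst (Tvar 0)) H1 = H.
  rewrite H1_inst -[RHS]fsubst_id; congr fsubst.
  by apply: functional_extensionality => -[|i].
have K_succ : fsubst (upd 0 (Tvar 0 ⊕ Tone)) K
    = fsubst (inst (tmin (Tvar 0 ⊕ Tone) t1)) H1.
  rewrite H1_inst fsubst_comp; congr fsubst.
  apply: functional_extensionality => -[|i] //=.
  by rewrite /t1 tsubst_comp.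
have step : M ⊢ Fall (K ⟶ fsubst (upd 0 (Tvar 0 ⊕ Tone)) K).
  (* The flow step is made a hypothesis so that the generalization shifts it and [prv_all_var0] can
     open it at the same variable. *)
  apply: prv_cut Hstep _; apply: prv_allI; set Gamma0 := map _ _.
  have stepH : prv M Gamma0 _ := prv_all_var0 _ _.
  apply/prv_impI; rewrite K_succ {1}/K -H1_inst.
  apply: (@lt_cases _ _ RM _ (Tvar 0) t1).
    set Gamma := _ :: _.
    have lt_ut : prv M Gamma (Tvar 0 ≺ t1) by apply: prv_hyp0.
    (* Discreteness turns [u < t] into [u + 1 <= t], so the minimum at the successor is [u + 1]
       itself. *)
    have /prv_eq_sym min_succ := tmin_l RM (R_discrete_le RM lt_ut).
    apply: prv_eqE min_succ _; rewrite H1_inst.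
    have {}stepH : prv M Gamma (H ⟶ fsubst (upd 0 (Tvar 0 ⊕ Tone)) H).
      by apply: prv_impE lt_ut; do 2! apply: prv_wk.
    apply: prv_impE stepH _; rewrite -H1_var0.
    by apply: prv_eqE (tmin_l RM (prv_andE1 lt_ut)) _; apply/prv_wk/prv_hyp0.
  set Gamma := _ :: _.
  have le_tu : prv M Gamma (t1 ≼ Tvar 0) by apply: prv_hyp0.
  have le_tu1 : prv M Gamma (t1 ≼ Tvar 0 ⊕ Tone).
    apply: prv_le_trans le_tu _ => //.
    exact: eq_le (prv_eqI _ _ _) (addC RM _ _ _) (le_addr RM _ _ _).
  apply: prv_eqE (prv_eq_sym (tmin_r RM le_tu1)) _.
  apply: prv_eqE (tmin_r RM le_tu) _.
  exact/prv_wk/prv_hyp0.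
apply: prv_impI; set Gamma := [:: X].
have base : prv M Gamma (fsubst (inst Tzero) K).
  rewrite K_inst; apply: prv_eqE (prv_eq_sym (tmin_l RM (le0 RM _ _))) _.
  exact: prv_impE (prv_nil _ (prv_andE2 HX)) (prv_hyp0 _ _ _).
have ind : prv M Gamma (induction_axiom K r).
  exact/prv_ax/BA_ind/TTr/PiS/PiH.
(* Being merely provably equal to the shifted [t], [r] may mention the induction variable; putting
   [Tzero] there gives [r0], provably equal to [t]. *)
have := prv_allE Tzero (prv_impE ind (prv_andI base (prv_nil _ step))).
pose r0 := tsubst (inst Tzero) r.
have -> : fsubst (inst Tzero) (fsubst (upd 0 r) K)
    = fsubst (inst (tmin r0 t)) H.
  rewrite -K_inst fsubst_comp; congr fsubst.
  by apply: functional_extensionality => -[|i].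
have le_tr : M ⊢ (t ≼ r0).
  apply: eq_leq => //; have := prv_eq_subst (inst Tzero) eq_r.
  by rewrite tsubst_shift_inst.
move=> prH; apply: prv_impE (prv_nil _ (prv_andE1 HY)) _.
exact: prv_eqE (tmin_r RM (prv_nil _ le_tr)) prH.
Qed.

Lemma mflow_sound M Psi flow Gamma Delta : subtheory Rth M ->
  (forall X Y, flow X Y -> M ⊢ (X ⟶ Y)) ->
  mflow Psi flow Gamma Delta -> proves_sequent M Gamma Delta.
Proof.
move=> RM sound [_ _ [X [Y [_ _ eqX eqY /sound prXY]]]]; apply: prv_impI.
apply: prv_impE (Requiv_prv _ RM eqY).1 _.
apply: prv_impE (prv_nil _ prXY) _.
exact: prv_impE (Requiv_prv _ RM eqX).2 (prv_hyp0 _ _ _).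
Qed.

End Flows.

Theorem theorem2p32 (L : language) (A B : theory L)
  (qfA : forall C : formula L, A C -> quantifier_free C)
  (RA : subtheory Rth A) (RB : subtheory Rth B) :
  (forall (Phi : formula L -> Prop) (k : nat) (Gamma Delta : seq (formula L)),
     bounded_class Phi -> contains_qf Phi -> boolean_closed Phi ->
     subst_closed Phi -> subformula_closed Phi ->
     term_ideal A T_all ->
     mflow (Pi_class Phi k) (dflow B Phi k) Gamma Delta ->
     subtheory B (bounded_arithmetic T_all (Pi_class Phi k) A) ->
     proves_sequent (bounded_arithmetic T_all (Pi_class Phi k) A) Gamma Delta)
  /\
  (forall (TT : term L -> Prop) (Pi : formula L -> Prop)
      (Gamma Delta : seq (formula L)),
     term_ideal A TT -> bounded_class Pi -> pi_class Pi ->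
     mflow Pi (nflow B TT Pi) Gamma Delta ->
     subtheory B (bounded_arithmetic TT Pi A) ->
     proves_sequent (bounded_arithmetic TT Pi A) Gamma Delta).
Proof.
have RM TT Pi : subtheory Rth (bounded_arithmetic TT Pi A).
  by move=> C /RA; apply: bounded_arithmetic_sub.
split=> [Phi k Gamma Delta _ _ _ PhiS _ [TTset _] flow BM
        |TT Pi Gamma Delta [TTset _] _ [[_ PiS _] _] flow BM].
  (* A deterministic flow is treated as a non-deterministic one over [T_all]; the class at level [k]
     inherits closure under substitution from [Phi]. *)
  apply: mflow_sound flow => // X Y /(dflow_nflow RB); apply: nflow_sound => //.
  exact: (hierarchy_subst_closed k PhiS).2.
by apply: mflow_sound flow => // X Y; apply: nflow_sound.
Qed.
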